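(* Let $\Phi_F=\{I,O,U,\mathit{Self},Q_n,N_n\mid n\in\mathbb N\setminus\{0\}\}$. Both $\mathcal L^{\sim}_\Phi$ and $\mathcal L^{\triangle}_\Phi$ are strictly more expressive than $\mathcal L_\Phi$: (1) w.r.t. concepts, for every $\Phi\subseteq\Phi_F$; (2) w.r.t. ABoxes, for every $\Phi\subseteq\Phi_F$ such that $\{I,O,U\}\setminus\Phi\ne\emptyset$ or $\Phi$ contains some $Q_n$ with $n\ge2$; (3) w.r.t. TBoxes, for every $\Phi\subseteq\Phi_F$ such that $\{I,O\}\setminus\Phi\ne\emptyset$ or $\Phi$ contains some $Q_n$ with $n\ge2$.
   Context: Gödel operations on $[0,1]$: $p\otimes q=\min\{p,q\}$, $p\oplus q=\max\{p,q\}$, $\ominus p=1$ if $p=0$ and $0$ otherwise, $(p\Rightarrow q)=1$ if $p\le q$ and $q$ otherwise. Fix pairwise disjoint sets $\mathsf{CN}$, $\mathsf{RN}$, $\mathsf{IN}$ of concept, role and individual names. A basic role w.r.t. $\Phi$ is $r\in\mathsf{RN}$, or $r^-$ when $I\in\Phi$. Roles and concepts of $\mathcal L_\Phi$: each $r\in\mathsf{RN}$ is a role; if $R,S$ are roles and $C$ a concept then $R\circ S$, $R\sqcup S$, $R^*$, $C?$ are roles; $R^-$ if $I\in\Phi$; $U$ if $U\in\Phi$; concepts: $p\in[0,1]$, $A\in\mathsf{CN}$, $C\sqcap D$, $C\to D$, $\neg C$, $C\sqcup D$, $\forall R.C$, $\exists R.C$; $\{a\}$ ($a\in\mathsf{IN}$)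 if $O\in\Phi$; $\exists r.\mathit{Self}$ if $\mathit{Self}\in\Phi$; ${\ge}n\,R.C$, ${<}n\,R.C$ for basic $R$ if $Q_n\in\Phi$; ${\ge}n\,R$, ${<}n\,R$ for basic $R$ if $N_n\in\Phi$. $\top$ is concept $1$. $\mathcal L^{\sim}_\Phi$ extends $\mathcal L_\Phi$ with the concept constructor $\mathord{\sim}C$ (involutive negation); $\triangle C$ abbreviates $\neg\mathord{\sim}C$; $\mathcal L^{\triangle}_\Phi$ is the largest sublanguage of $\mathcal L^{\sim}_\Phi$ using $\mathord{\sim}$ only in the form $\neg\mathord{\sim}C$. A fuzzy interpretation $\mathcal I$ has a nonempty domain $\Delta^{\mathcal I}$, $a^{\mathcal I}\in\Delta^{\mathcal I}$, $A^{\mathcal I}:\Delta^{\mathcal I}\to[0,1]$, $r^{\mathcal I}:(\Delta^{\mathcal I})^2\to[0,1]$, extended by: $U^{\mathcal I}\equiv1$; $(R^-)^{\mathcal I}(x,y)=R^{\mathcal I}(y,x)$; $(C?)^{\mathcal I}(x,y)=C^{\mathcal I}(x)$ if $x=y$, else $0$; $(R\circ S)^{\mathcal I}(x,y)=\sup_z R^{\mathcal I}(x,z)\otimes S^{\mathcal I}(z,y)$; $(R\sqcup S)^{\mathcal I}=R^{\mathcal I}\oplus S^{\mathcal I}$; $(R^* )^{\mathcal I}(x,y)=\sup\{\min(\{1\}\cup\{R^{\mathcal I}(x_i,x_{i+1})\mid i<n\})\mid n\ge0,x_0=x,x_n=y\}$; $p^{\mathcal I}(x)=p$; $\{a\}^{\mathcal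 I}(x)=1$ iff $x=a^{\mathcal I}$, else $0$; $(\neg C)^{\mathcal I}=\ominus C^{\mathcal I}$; $(\mathord{\sim}C)^{\mathcal I}(x)=1-C^{\mathcal I}(x)$; $\sqcap,\sqcup,\to$ pointwise by $\otimes,\oplus,\Rightarrow$; $(\exists r.\mathit{Self})^{\mathcal I}(x)=r^{\mathcal I}(x,x)$; $(\exists R.C)^{\mathcal I}(x)=\sup_y R^{\mathcal I}(x,y)\otimes C^{\mathcal I}(y)$; $(\forall R.C)^{\mathcal I}(x)=\inf_y(R^{\mathcal I}(x,y)\Rightarrow C^{\mathcal I}(y))$; $({\ge}n\,R.C)^{\mathcal I}(x)=\sup\{\min_i(R^{\mathcal I}(x,y_i)\otimes C^{\mathcal I}(y_i))\mid y_1..y_n$ pairwise distinct$\}$; $({<}n\,R.C)^{\mathcal I}(x)=\inf\{\min_i(R^{\mathcal I}(x,y_i)\otimes C^{\mathcal I}(y_i))\Rightarrow e\mid y_1..y_n\}$ with $e=1$ if some $y_j=y_k$ ($j<k$), else $0$; ${\ge}n\,R={\ge}n\,R.\top$, ${<}n\,R={<}n\,R.\top$. A fuzzy assertion in a language $L$ is $a\doteq b$, $a\not\doteq b$, $C(a)\bowtie p$ or $R(a,b)\bowtie p$ ($C$ a concept, $R$ a role of $L$, $\bowtie\in\{\ge,>,\le,<\}$, $p\in[0,1]$), validated by $\mathcal I$ iff respectively $a^{\mathcal I}=b^{\mathcal I}$, $a^{\mathcal I}\ne b^{\mathcal I}$, $C^{\mathcal I}(a^{\mathcal I})\bowtie p$,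 $R^{\mathcal I}(a^{\mathcal I},b^{\mathcal I})\bowtie p$; a fuzzy ABox is a finite set of them. A fuzzy GCI is $(C\sqsubseteq D)\rhd p$ ($C,D$ concepts of $L$, $\rhd\in\{\ge,>\}$, $p\in(0,1]$), validated iff $(C\to D)^{\mathcal I}(x)\rhd p$ for all $x$; a fuzzy TBox is a finite set of them. Two concepts are equivalent if they have the same interpretation in every fuzzy interpretation. A concept (resp. fuzzy TBox, fuzzy ABox) cannot be expressed in a logic $L$ if there is no equivalent concept of $L$ (resp. no fuzzy TBox, fuzzy ABox in $L$ with exactly the same models). If $L$ is a sublogic of $L'$ and some concept (resp. fuzzy TBox, fuzzy ABox) of $L'$ cannot be expressed in $L$, then $L'$ is strictly more expressive than $L$ w.r.t. concepts (resp. TBoxes, ABoxes). *)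

(* Defs.v *)
From HB Require Import structures.
From mathcomp Require Import all_boot all_order all_algebra.
From mathcomp Require Import boolp classical_sets functions cardinality reals.

Set Implicit Arguments.
Unset Strict Implicit.
Unset Printing Implicit Defensive.

Import Order.TTheory GRing.Theory Num.Theory.

Local Open Scope classical_set_scope.
Local Open Scope ring_scope.

Inductive feature : Type := FI | FO | FU | FSelf | FQ (n : nat) | FN (n : nat).

Definition PhiF : set feature :=
  [set f | match f with FQ n | FN n => (0 < n)%N | _ => True end].

(** The raw syntax contains every constructor, including the involutive
    negation; the individual logics are carved out by [in_role]/[in_concept]
    below. The name sets are separate types, hence pairwise disjoint. *)
Section Syntax.
Context (R : realType) (CN RN IN : Type).

Inductive role : Type :=
| RName (r : RN)
| RComp (S T : role)
| RUnion (S T : role)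
| RStar (S : role)
| RTest (C : concept)
| RInv (S : role)
| RUniv
with concept : Type :=
| CConst (p : R)
| CName (A : CN)
| CAnd (C D : concept)
| CImpl (C D : concept)
| CNeg (C : concept)
| COr (C D : concept)
| CForall (S : role) (C : concept)
| CExists (S : role) (C : concept)
| CNominal (a : IN)
| CSelf (r : RN)
| CAtLeastQ (n : nat) (S : role) (C : concept)
| CLessQ (n : nat) (S : role) (C : concept)
| CAtLeastN (n : nat) (S : role)
| CLessN (n : nat) (S : role)
| CInvol (C : concept).

Definition basic_role (Phi : set feature) (S : role) : Prop :=
  (exists r, S = RName r) \/ (Phi FI /\ exists r, S = RInv (RName r)).

(** How [CInvol] may be used: not at all, only in the form [CNeg (CInvol C)],
    or freely. *)
Inductive invol_mode : Type := NoInvol | BaazOnly | FullInvol.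

Inductive in_role (m : invol_mode) (Phi : set feature) : role -> Prop :=
| in_RName r : in_role m Phi (RName r)
| in_RComp S T : in_role m Phi S -> in_role m Phi T -> in_role m Phi (RComp S T)
| in_RUnion S T :
    in_role m Phi S -> in_role m Phi T -> in_role m Phi (RUnion S T)
| in_RStar S : in_role m Phi S -> in_role m Phi (RStar S)
| in_RTest C : in_concept m Phi C -> in_role m Phi (RTest C)
| in_RInv S : Phi FI -> in_role m Phi S -> in_role m Phi (RInv S)
| in_RUniv : Phi FU -> in_role m Phi RUniv
with in_concept (m : invol_mode) (Phi : set feature) : concept -> Prop :=
| in_CConst p : 0 <= p <= 1 -> in_concept m Phi (CConst p)
| in_CName A : in_concept m Phi (CName A)
| in_CAnd C D :
    in_concept m Phi C -> in_concept m Phi D -> in_concept m Phi (CAnd C D)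
| in_CImpl C D :
    in_concept m Phi C -> in_concept m Phi D -> in_concept m Phi (CImpl C D)
| in_CNeg C : in_concept m Phi C -> in_concept m Phi (CNeg C)
| in_COr C D :
    in_concept m Phi C -> in_concept m Phi D -> in_concept m Phi (COr C D)
| in_CForall S C :
    in_role m Phi S -> in_concept m Phi C -> in_concept m Phi (CForall S C)
| in_CExists S C :
    in_role m Phi S -> in_concept m Phi C -> in_concept m Phi (CExists S C)
| in_CNominal a : Phi FO -> in_concept m Phi (CNominal a)
| in_CSelf r : Phi FSelf -> in_concept m Phi (CSelf r)
| in_CAtLeastQ n S C :
    Phi (FQ n) -> basic_role Phi S -> in_concept m Phi C ->
    in_concept m Phi (CAtLeastQ n S C)
| in_CLessQ n S C :
    Phi (FQ n) -> basic_role Phi S -> in_concept m Phi C ->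
    in_concept m Phi (CLessQ n S C)
| in_CAtLeastN n S :
    Phi (FN n) -> basic_role Phi S -> in_concept m Phi (CAtLeastN n S)
| in_CLessN n S :
    Phi (FN n) -> basic_role Phi S -> in_concept m Phi (CLessN n S)
| in_CBaaz C :
    m = BaazOnly -> in_concept m Phi C -> in_concept m Phi (CNeg (CInvol C))
| in_CInvol C :
    m = FullInvol -> in_concept m Phi C -> in_concept m Phi (CInvol C).

Record logic : Type := Logic { lroles : set role; lconcepts : set concept }.

Definition sublogic (L L' : logic) : Prop :=
  lroles L `<=` lroles L' /\ lconcepts L `<=` lconcepts L'.

Definition logic_of (m : invol_mode) (Phi : set feature) : logic :=
  Logic (in_role m Phi) (in_concept m Phi).

Definition LPhi := logic_of NoInvol.
Definition LBaaz := logic_of BaazOnly.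
Definition LInvol := logic_of FullInvol.

End Syntax.

Section Semantics.
Context (R : realType) (CN RN IN : Type).

Record interp : Type := Interp {
  idom : Type;
  idom_nonempty : inhabited idom;
  iind : IN -> idom;
  icon : CN -> idom -> R;
  irole : RN -> idom -> idom -> R;
  icon_itv : forall A x, 0 <= icon A x <= 1;
  irole_itv : forall r x y, 0 <= irole r x y <= 1 }.

Definition gneg (p : R) : R := if p == 0 then 1 else 0.

Definition gimpl (p q : R) : R := if p <= q then 1 else q.

(** In the next three definitions the initial value [1] of the iterated minimum
    is neutral, all values being at most [1]. *)

Definition star_sem (T : Type) (S : T -> T -> R) (x y : T) : R :=
  sup [set v | exists (n : nat) (z : nat -> T),
    [/\ z 0%N = x, z n = y & v = \big[Num.min/1]_(i < n) S (z i) (z i.+1)]].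

(** If there are no [n] distinct elements, this is [sup set0], which is [0] as
    it should be for the supremum of the empty set in the lattice [[0, 1]]. *)
Definition at_least_sem (T : Type) (n : nat) (S : T -> T -> R) (C : T -> R)
    (x : T) : R :=
  sup [set v | exists y : 'I_n -> T,
    injective y /\ v = \big[Num.min/1]_(i < n) Num.min (S x (y i)) (C (y i))].

Definition less_sem (T : Type) (n : nat) (S : T -> T -> R) (C : T -> R)
    (x : T) : R :=
  inf [set v | exists y : 'I_n -> T,
    v = gimpl (\big[Num.min/1]_(i < n) Num.min (S x (y i)) (C (y i)))
          (if `[< exists j k : 'I_n, (j < k)%N /\ y j = y k >] then 1 else 0)].

Fixpoint role_sem (I : interp) (S : role R CN RN IN) : idom I -> idom I -> R :=
  match S with
  | RName r => irole r
  | RComp P Q => fun x y =>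
      sup [set Num.min (role_sem P x z) (role_sem Q z y) | z in [set: idom I]]
  | RUnion P Q => fun x y => Num.max (role_sem P x y) (role_sem Q x y)
  | RStar P => star_sem (role_sem P)
  | RTest C => fun x y => if `[< x = y >] then concept_sem C x else 0
  | RInv P => fun x y => role_sem P y x
  | RUniv => fun _ _ => 1
  end
with concept_sem (I : interp) (C : concept R CN RN IN) : idom I -> R :=
  match C with
  | CConst p => fun _ => p
  | CName A => icon A
  | CAnd C D => fun x => Num.min (concept_sem C x) (concept_sem D x)
  | CImpl C D => fun x => gimpl (concept_sem C x) (concept_sem D x)
  | CNeg C => fun x => gneg (concept_sem C x)
  | COr C D => fun x => Num.max (concept_sem C x) (concept_sem D x)
  | CForall P C => fun x =>
      inf [set gimpl (role_sem P x y) (concept_sem C y) | y in [set: idom I]]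
  | CExists P C => fun x =>
      sup [set Num.min (role_sem P x y) (concept_sem C y) | y in [set: idom I]]
  | CNominal a => fun x => if `[< x = iind I a >] then 1 else 0
  | CSelf r => fun x => irole r x x
  | CAtLeastQ n P C => at_least_sem n (role_sem P) (concept_sem C)
  | CLessQ n P C => less_sem n (role_sem P) (concept_sem C)
  | CAtLeastN n P => at_least_sem n (role_sem P) (fun _ => 1)
  | CLessN n P => less_sem n (role_sem P) (fun _ => 1)
  | CInvol C => fun x => 1 - concept_sem C x
  end.

Inductive cmp : Type := CmpGe | CmpGt | CmpLe | CmpLt.

Definition cmp_sem (o : cmp) (v p : R) : Prop :=
  match o with
  | CmpGe => v >= p
  | CmpGt => v > p
  | CmpLe => v <= p
  | CmpLt => v < p
  end.

Inductive assertion : Type :=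
| AEq (a b : IN)
| ANeq (a b : IN)
| AConcept (C : concept R CN RN IN) (a : IN) (o : cmp) (p : R)
| ARole (S : role R CN RN IN) (a b : IN) (o : cmp) (p : R).

Definition assertion_in (L : logic R CN RN IN) (phi : assertion) : Prop :=
  match phi with
  | AEq _ _ | ANeq _ _ => True
  | AConcept C _ _ p => lconcepts L C /\ 0 <= p <= 1
  | ARole P _ _ _ p => lroles L P /\ 0 <= p <= 1
  end.

Definition validates_assertion (I : interp) (phi : assertion) : Prop :=
  match phi with
  | AEq a b => iind I a = iind I b
  | ANeq a b => iind I a <> iind I b
  | AConcept C a o p => cmp_sem o (concept_sem C (iind I a)) p
  | ARole P a b o p => cmp_sem o (role_sem P (iind I a) (iind I b)) p
  end.

Record gci : Type := Gci {
  glhs : concept R CN RN IN;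
  grhs : concept R CN RN IN;
  gcmp : cmp;
  gdeg : R }.

Definition gci_in (L : logic R CN RN IN) (g : gci) : Prop :=
  [/\ lconcepts L (glhs g), lconcepts L (grhs g),
      gcmp g = CmpGe \/ gcmp g = CmpGt & 0 < gdeg g <= 1].

Definition validates_gci (I : interp) (g : gci) : Prop :=
  forall x : idom I,
    cmp_sem (gcmp g) (concept_sem (CImpl (glhs g) (grhs g)) x) (gdeg g).

Definition is_abox (L : logic R CN RN IN) (A : set assertion) : Prop :=
  finite_set A /\ A `<=` assertion_in L.

Definition is_tbox (L : logic R CN RN IN) (T : set gci) : Prop :=
  finite_set T /\ T `<=` gci_in L.

Definition abox_model (A : set assertion) (I : interp) : Prop :=
  forall phi, A phi -> validates_assertion I phi.

Definition tbox_model (T : set gci) (I : interp) : Prop :=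
  forall g, T g -> validates_gci I g.

Definition equiv_concept (C D : concept R CN RN IN) : Prop :=
  forall (I : interp) (x : idom I), concept_sem C x = concept_sem D x.

Definition equiv_abox (A B : set assertion) : Prop :=
  forall I : interp, abox_model A I <-> abox_model B I.

Definition equiv_tbox (T T' : set gci) : Prop :=
  forall I : interp, tbox_model T I <-> tbox_model T' I.

Definition more_expressive_concepts (L' L : logic R CN RN IN) : Prop :=
  sublogic L L' /\
  exists C, lconcepts L' C /\ ~ exists D, lconcepts L D /\ equiv_concept C D.

Definition more_expressive_aboxes (L' L : logic R CN RN IN) : Prop :=
  sublogic L L' /\
  exists A, is_abox L' A /\ ~ exists B, is_abox L B /\ equiv_abox A B.

Definition more_expressive_tboxes (L' L : logic R CN RN IN) : Prop :=
  sublogic L L' /\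
  exists T, is_tbox L' T /\ ~ exists T', is_tbox L T' /\ equiv_tbox T T'.

End Semantics.

(* Main.v *)
Require Import Defs.
From HB Require Import structures.
From mathcomp Require Import all_boot all_order all_algebra.
From mathcomp Require Import boolp classical_sets functions cardinality reals.
From mathcomp Require Import ring lra.

(** A map [h] of [[0, 1]] that is a complete homomorphism of Goedel algebras and
    fixes the constants of an [LPhi]-concept transports its value along any
    bijection of domains that transports the atoms through [h]; no feature
    breaks this. For [c < 1] above all constants other than [1], take two
    interpretations with domain [R], individuals [0] and all roles constantly
    [1]: in one the concept names take all values of [(c, 1)] but not [1], in
    the other all values of [(c, 1]]. For every [k > 0], the scaling [y |-> k y]
    maps the first onto the second through the map [collapse c k], which fixes
    [[0, c]] and sends an upper end [[u, 1]] to [1], with [u -> 1] as [k -> 0].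
    Comparing all [k] shows that the two interpretations validate the same
    [LPhi]-assertions and GCIs over these constants, whereas [exists r.(triangle A)]
    is constantly [0] in the first and [1] in the second. *)

Set Implicit Arguments.
Unset Strict Implicit.
Unset Printing Implicit Defensive.

Import Order.TTheory GRing.Theory Num.Theory.

Local Open Scope classical_set_scope.

(** * Suprema and infima in [[0, 1]], and complete homomorphisms of Goedel algebras *)

Section UnitInterval.
Local Open Scope ring_scope.
Variable R : realType.
Implicit Types (S : set R) (p q v w : R).

Definition in_unit S : Prop := forall v, S v -> 0 <= v <= 1.

Lemma in_unit_has_ubound {S} : in_unit S -> has_ubound S.
Proof. by move=> S01; exists 1 => v /S01 /andP[]. Qed.

Lemma in_unit_has_lbound {S} : in_unit S -> has_lbound S.
Proof. by move=> S01; exists 0 => v /S01 /andP[]. Qed.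

Lemma sup_unit S : in_unit S -> 0 <= sup S <= 1.
Proof.
move=> S01; case: (pselect (S !=set0)) => [[v Sv]|/set0P/negP/negPn/eqP->]; last first.
  by rewrite sup0 lexx ler01.
have /andP[v0 _] := S01 v Sv; apply/andP; split.
  by apply: le_trans v0 _; apply: ub_le_sup => //; exact: in_unit_has_ubound.
by apply: ge_sup; [exists v | move=> w /S01 /andP[]].
Qed.

Lemma inf_unit S : S !=set0 -> in_unit S -> 0 <= inf S <= 1.
Proof.
move=> [v Sv] S01; have /andP[_ v1] := S01 v Sv; apply/andP; split.
  by apply: lb_le_inf; [exists v | move=> w /S01 /andP[]].
by apply: le_trans _ v1; apply: ge_inf => //; exact: in_unit_has_lbound.
Qed.

Lemma unit1 : 0 <= (1 : R) <= 1.
Proof. by rewrite ler01 lexx. Qed.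

Lemma min_unit p q : 0 <= p <= 1 -> 0 <= q <= 1 -> 0 <= Num.min p q <= 1.
Proof. by case: (leP p q). Qed.

Lemma max_unit p q : 0 <= p <= 1 -> 0 <= q <= 1 -> 0 <= Num.max p q <= 1.
Proof. by case: (leP p q). Qed.

Lemma bigmin_unit (n : nat) (F : 'I_n -> R) :
  (forall i, 0 <= F i <= 1) -> 0 <= \big[Num.min/1]_(i < n) F i <= 1.
Proof.
move=> F01; elim/big_ind: _ => [|p q p01 q01|i _ //]; first by rewrite lexx ler01.
exact: min_unit.
Qed.

Lemma gimpl_unit p q : 0 <= q <= 1 -> 0 <= gimpl p q <= 1.
Proof. by rewrite /gimpl; case: ifP => // _ _; rewrite lexx ler01. Qed.

Lemma gneg_unit p : 0 <= gneg p <= 1.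
Proof. by rewrite /gneg; case: ifP => _; rewrite lexx ler01. Qed.

(** Monotonicity, preservation of suprema and infima, and strictness below [1]
    all follow from the lower adjoint [l] (on [[0, 1]]) being an upper adjoint
    as well below [1]. *)
Definition godel_hom (h : R -> R) : Prop :=
  [/\ h 0 = 0, h 1 = 1, forall v, h v <= 1 &
   exists l : R -> R,
     (forall v w, w <= 1 -> (w <= h v) = (l w <= v)) /\
     (forall v w, w < 1 -> (h v <= w) = (v <= l w))].

Section GodelHom.
Variable h : R -> R.
Hypothesis hh : godel_hom h.

Lemma godel_hom_mono p q : p <= q -> h p <= h q.
Proof.
case: hh => _ _ h1 [l [lP _]] pq.
by rewrite lP ?h1// (le_trans _ pq)// -lP ?h1.
Qed.

(** If [h p <= h q < 1], the two adjunctions give [p <= l (h q) <= q]. *)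
Lemma godel_hom_strict p q : h q < 1 -> q < p -> h q < h p.
Proof.
case: hh => _ _ h1 [l [lP uP]] hq1 qp; rewrite ltNge; apply/negP => hpq.
have := qp; rewrite ltNge => /negP; apply.
by apply: (@le_trans _ _ (l (h q))); rewrite -?uP// -lP// ltW.
Qed.

Lemma godel_hom_unit p : 0 <= p <= 1 -> 0 <= h p <= 1.
Proof.
case: hh => h0 _ h1 _ /andP[p0 _]; rewrite h1 andbT -h0.
exact: godel_hom_mono.
Qed.

Lemma godel_hom_min : {morph h : p q / Num.min p q}.
Proof.
move=> p q; case: (leP p q) => [|/ltW] pq; have := godel_hom_mono pq.
  by move=> /min_idPl ->.
by move=> /min_idPr ->.
Qed.

Lemma godel_hom_max : {morph h : p q / Num.max p q}.
Proof.
move=> p q; case: (leP p q) => [|/ltW] pq; have := godel_hom_mono pq.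
  by move=> /max_idPr ->.
by move=> /max_idPl ->.
Qed.

Lemma godel_hom_bigmin (n : nat) (F : 'I_n -> R) :
  h (\big[Num.min/1]_(i < n) F i) = \big[Num.min/1]_(i < n) h (F i).
Proof. by case: hh => _ h1 _ _; apply: (big_morph h godel_hom_min h1). Qed.

(** The delicate case is [q < p] with [h p <= h q]: strictness then forces [h q = 1], so both sides
    are [1]. *)
Lemma godel_hom_impl : {morph h : p q / gimpl p q}.
Proof.
case: (hh) => _ h1 hle _ p q; rewrite /gimpl.
case: (leP p q) => pq; first by rewrite (godel_hom_mono pq).
case: leP => // hpq; apply/eqP; rewrite eq_le hle leNgt; apply/negP => hq1.
by have := godel_hom_strict hq1 pq; rewrite ltNge hpq.
Qed.

(** Negation only asks whether a value is [0], and both adjunctions at [w = 0] show that [h] keeps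
    this, since [l 0 = 0]. *)
Lemma godel_hom_neg : {morph h : p / gneg p}.
Proof.
move=> p; case: (hh) => h0 h1 hle [l [lP uP]].
have l0 : l 0 = 0.
  by apply/eqP; rewrite eq_le -uP ?ltr01// -lP ?ler01// h0 lexx.
have hp0 : (h p == 0) = (p == 0).
  by rewrite eq_le uP ?ltr01// lP ?ler01// l0 -eq_le.
by rewrite /gneg hp0; case: ifP.
Qed.

Lemma godel_hom_sup S : in_unit S -> h (sup S) = sup (h @` S).
Proof.
case: (hh) => h0 h1 hle [l [lP uP]] S01.
case: (pselect (S !=set0)) => [S0|/set0P/negP/negPn/eqP->]; last first.
  (* The default value [sup set0 = 0] is matched by [h 0 = 0]. *)
  by rewrite image_set0 !sup0.
have hS01 : in_unit (h @` S) by move=> _ [v /S01 v01 <-]; exact: godel_hom_unit.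
apply/eqP; rewrite eq_le; apply/andP; split; last first.
  apply: ge_sup; first by case: S0 => v Sv; exists (h v), v.
  move=> _ [v Sv <-]; apply: godel_hom_mono.
  by apply: ub_le_sup => //; exact: in_unit_has_ubound.
(* The second adjunction covers only bounds below [1]; a bound of at least [1] is trivial because
   [h] never exceeds [1]. *)
have [|w1] := leP 1 (sup (h @` S)); first exact: le_trans.
rewrite uP//; apply: ge_sup => // v Sv; rewrite -uP//.
by apply: ub_le_sup; [exact: in_unit_has_ubound | exists v].
Qed.

Lemma godel_hom_inf S : S !=set0 -> in_unit S -> h (inf S) = inf (h @` S).
Proof.
case: (hh) => h0 h1 hle [l [lP uP]] S0 S01.
have hS0 : (h @` S) !=set0 by case: S0 => v Sv; exists (h v), v.
have hS01 : in_unit (h @` S) by move=> _ [v /S01 v01 <-]; exact: godel_hom_unit.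
have /andP[_ w1] := inf_unit hS0 hS01.
apply/eqP; rewrite eq_le; apply/andP; split.
  apply: lb_le_inf => // _ [v Sv <-]; apply: godel_hom_mono.
  by apply: ge_inf => //; exact: in_unit_has_lbound.
rewrite lP//; apply: lb_le_inf => // v Sv; rewrite -lP//.
by apply: ge_inf; [exact: in_unit_has_lbound | exists v].
Qed.

End GodelHom.

End UnitInterval.

(** * Transport of the semantic operations along a homomorphism of values and a bijection of
    domains *)

Section Transport.
Local Open Scope ring_scope.
Variables (R : realType) (h : R -> R).
Hypothesis hh : godel_hom h.

(** The range condition is carried along because [godel_hom_sup] and [godel_hom_inf] ask for sets
    inside [[0, 1]]. *)
Definition transported (v v' : R) : Prop := 0 <= v <= 1 /\ v' = h v.

Lemma transported0 : transported 0 0.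
Proof. by case: hh => h0 _ _ _; split; rewrite ?h0// lexx ler01. Qed.

Lemma transported1 : transported 1 1.
Proof. by case: hh => _ h1 _ _; split; rewrite ?h1// lexx ler01. Qed.

Lemma transported_min p p' q q' : transported p p' -> transported q q' ->
  transported (Num.min p q) (Num.min p' q').
Proof.
by move=> [p01 ->] [q01 ->]; split; rewrite ?godel_hom_min//; exact: min_unit.
Qed.

Lemma transported_max p p' q q' : transported p p' -> transported q q' ->
  transported (Num.max p q) (Num.max p' q').
Proof.
by move=> [p01 ->] [q01 ->]; split; rewrite ?godel_hom_max//; exact: max_unit.
Qed.

Lemma transported_impl p p' q q' : transported p p' -> transported q q' ->
  transported (gimpl p q) (gimpl p' q').
Proof.
by move=> [p01 ->] [q01 ->]; split; rewrite ?godel_hom_impl//; exact: gimpl_unit.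
Qed.

Lemma transported_neg p p' : transported p p' ->
  transported (gneg p) (gneg p').
Proof.
by move=> [p01 ->]; split; rewrite ?godel_hom_neg//; exact: gneg_unit.
Qed.

Lemma transported_bigmin (n : nat) (F F' : 'I_n -> R) :
  (forall i, transported (F i) (F' i)) ->
  transported (\big[Num.min/1]_(i < n) F i) (\big[Num.min/1]_(i < n) F' i).
Proof.
move=> FF'; split; first by apply: bigmin_unit => i; case: (FF' i).
by rewrite godel_hom_bigmin//; apply: eq_bigr => i _; case: (FF' i).
Qed.

(** The back-and-forth conditions amount to [S'] being the image of [S] under [h]. *)
Lemma transported_sup (S S' : set R) :
  (forall v, S v -> exists2 v', S' v' & transported v v') ->
  (forall v', S' v' -> exists2 v, S v & transported v v') ->
  transported (sup S) (sup S').
Proof.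
move=> SS' S'S.
have S01 : in_unit S by move=> v /SS'[v' _ []].
split; first exact: sup_unit.
rewrite godel_hom_sup//; congr sup; apply/seteqP; split => v'.
  by move=> /S'S[v Sv [_ v'E]]; exists v.
by move=> [v /SS'[w S'w [_ <-]] <-].
Qed.

Lemma transported_inf (S S' : set R) : S !=set0 ->
  (forall v, S v -> exists2 v', S' v' & transported v v') ->
  (forall v', S' v' -> exists2 v, S v & transported v v') ->
  transported (inf S) (inf S').
Proof.
move=> S0 SS' S'S.
have S01 : in_unit S by move=> v /SS'[v' _ []].
split; first exact: inf_unit.
rewrite godel_hom_inf//; congr inf; apply/seteqP; split => v'.
  by move=> /S'S[v Sv [_ v'E]]; exists v.
by move=> [v /SS'[w S'w [_ <-]] <-].
Qed.

Variables (T T' : Type) (f : T -> T') (g : T' -> T).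
Hypotheses (fK : cancel f g) (gK : cancel g f).

Lemma transported_sup_range (F : T -> R) (F' : T' -> R) :
  (forall x, transported (F x) (F' (f x))) ->
  transported (sup [set F x | x in [set: T]]) (sup [set F' x | x in [set: T']]).
Proof.
move=> FF'; apply: transported_sup => [_ [x _ <-]|_ [x _ <-]].
  by exists (F' (f x)) => //; exists (f x).
by exists (F (g x)); [exists (g x) | rewrite -{2}(gK x)].
Qed.

Lemma transported_inf_range (F : T -> R) (F' : T' -> R) : inhabited T ->
  (forall x, transported (F x) (F' (f x))) ->
  transported (inf [set F x | x in [set: T]]) (inf [set F' x | x in [set: T']]).
Proof.
move=> [x0] FF'; apply: transported_inf => [|_ [x _ <-]|_ [x _ <-]].
- by exists (F x0), x0.
- by exists (F' (f x)) => //; exists (f x).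
- by exists (F (g x)); [exists (g x) | rewrite -{2}(gK x)].
Qed.

Variables (S : T -> T -> R) (S' : T' -> T' -> R).
Hypothesis SS' : forall x y, transported (S x y) (S' (f x) (f y)).

Lemma transported_star x y :
  transported (star_sem S x y) (star_sem S' (f x) (f y)).
Proof.
apply: transported_sup => v [n [z [z0 zn ->]]].
- exists (\big[Num.min/1]_(i < n) S' (f (z i)) (f (z i.+1))).
    by exists n, (f \o z); rewrite /= z0 zn.
  exact: transported_bigmin.
- exists (\big[Num.min/1]_(i < n) S (g (z i)) (g (z i.+1))).
    by exists n, (g \o z); rewrite /= z0 zn !fK.
  apply: transported_bigmin => i.
  by rewrite -{2}(gK (z i)) -{2}(gK (z i.+1)).
Qed.

Variables (C : T -> R) (C' : T' -> R).
Hypothesis CC' : forall x, transported (C x) (C' (f x)).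

(** Keeping [y'] apart from [f \o y] lets the lemma serve both directions: a tuple of [T] pushed
    forward by [f], or a tuple of [T'] pulled back by [g]. *)
Lemma transported_succs (n : nat) x (y : 'I_n -> T) (y' : 'I_n -> T') :
  (forall i, y' i = f (y i)) ->
  transported (\big[Num.min/1]_(i < n) Num.min (S x (y i)) (C (y i)))
    (\big[Num.min/1]_(i < n) Num.min (S' (f x) (y' i)) (C' (y' i))).
Proof.
by move=> yE; apply: transported_bigmin => i; rewrite yE; exact: transported_min.
Qed.

Lemma transported_at_least n x :
  transported (at_least_sem n S C x) (at_least_sem n S' C' (f x)).
Proof.
apply: transported_sup => _ [y [yI ->]].
- exists (\big[Num.min/1]_(i < n) Num.min (S' (f x) (f (y i))) (C' (f (y i)))).
    by exists (f \o y); split=> //; exact: inj_comp (can_inj fK) yI.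
  exact: transported_succs.
- exists (\big[Num.min/1]_(i < n) Num.min (S x (g (y i))) (C (g (y i)))).
    by exists (g \o y); split=> //; exact: inj_comp (can_inj gK) yI.
  by apply: transported_succs => i; rewrite gK.
Qed.

Lemma transported_less n x :
  transported (less_sem n S C x) (less_sem n S' C' (f x)).
Proof.
(* Injective maps keep the equality pattern of a tuple, so the crisp bound [0] or [1] is the same on
   both sides. *)
have pairE U V (u : U -> V) (y : 'I_n -> U) : injective u ->
    `[< exists j k : 'I_n, (j < k)%N /\ (u \o y) j = (u \o y) k >] =
    `[< exists j k : 'I_n, (j < k)%N /\ y j = y k >].
  move=> uI; apply: asbool_equiv_eq; split=> -[j [k [jk yjk]]]; exists j, k; split=> //.
    exact: uI.
  by rewrite /= yjk.
have step (y : 'I_n -> T) (y' : 'I_n -> T') : y' = f \o y -> transported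
    (gimpl (\big[Num.min/1]_(i < n) Num.min (S x (y i)) (C (y i)))
      (if `[< exists j k : 'I_n, (j < k)%N /\ y j = y k >] then 1 else 0))
    (gimpl (\big[Num.min/1]_(i < n) Num.min (S' (f x) (y' i)) (C' (y' i)))
      (if `[< exists j k : 'I_n, (j < k)%N /\ y' j = y' k >] then 1 else 0)).
  move=> ->; apply: transported_impl; first exact: transported_succs.
  rewrite pairE; last exact: can_inj fK.
  by case: ifP => _; [exact: transported1 | exact: transported0].
apply: transported_inf => [|_ [y ->]|_ [y ->]].
- by eexists; exists (fun=> x).
- by eexists; [exists (f \o y) | exact: step].
- eexists; first by exists (g \o y).
  by apply: step; apply/funext => i /=; rewrite gK.
Qed.

End Transport.

(** * Properties of thresholds [c] that hold eventually as [c] tends to [1] from below *)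

Section NearOne.
Local Open Scope ring_scope.
Variable R : realType.
Implicit Types P Q : R -> Prop.

(** Each constant, concept or assertion may choose its own threshold, and finitely many of them are
    met by one [c]. *)
Definition near_one P : Prop :=
  exists2 c, 0 <= c < 1 & forall c', c <= c' < 1 -> P c'.

Lemma near_oneT P : (forall c, P c) -> near_one P.
Proof. by move=> P1; exists 0; rewrite ?lexx ?ltr01. Qed.

Lemma near_oneS P Q : (forall c, P c -> Q c) -> near_one P -> near_one Q.
Proof. by move=> PQ [c c01 Pc]; exists c => // c' /Pc /PQ. Qed.

Lemma near_oneI P Q : near_one P -> near_one Q -> near_one (fun c => P c /\ Q c).
Proof.
move=> [c /andP[c0 c1] Pc] [d /andP[d0 d1] Qd].
exists (Num.max c d); first by rewrite le_max c0 gt_max c1 d1.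
by move=> e; rewrite ge_max => /andP[/andP[ce de] e1]; split;
  [apply: Pc | apply: Qd]; rewrite ?ce ?de.
Qed.

(** The disjunct [p = 1] is there because no [c < 1] lies above [1]; that constant is fixed by every
    [godel_hom]. *)
Lemma near_one_const p : 0 <= p <= 1 -> near_one (fun c => p <= c \/ p = 1).
Proof.
move=> /andP[p0]; rewrite le_eqVlt => /orP[/eqP p1|p1].
  by apply: near_oneT => c; right.
by exists p => [|c /andP[pc _]]; [rewrite p0 | left].
Qed.

Lemma near_one_finite (T : Type) (A : set T) (P : R -> T -> Prop) :
  finite_set A -> (forall a, A a -> near_one (P^~ a)) ->
  near_one (fun c => forall a, A a -> P c a).
Proof.
(* [{classic T}] supplies the decidable equality that turns the finite set into a list. *)
move=> /(@finite_seqP {classic T})[s ->].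
elim: s => [|a s IHs] PA; first by apply: near_oneT.
have Ps : near_one (fun c => forall b : {classic T}, b \in s -> P c b).
  by apply: IHs => b /= bs; apply: PA; rewrite /= inE bs orbT.
have Pa : near_one (P^~ a) by apply: PA; rewrite /= mem_head.
apply: near_oneS (near_oneI Pa Ps) => c [Pca Pcs] b /=.
by rewrite inE => /orP[/eqP->|/Pcs].
Qed.

Lemma near_one_ex P : near_one P -> exists2 c, 0 <= c < 1 & P c.
Proof.
move=> [c c01 Pc]; exists c => //; apply: Pc.
by case/andP: c01 => _ ->; rewrite lexx.
Qed.

End NearOne.

(* Invariance under similarities of the roles and concepts without involution *)
Scheme in_role_mut := Minimality for in_role Sort Prop
with in_concept_mut := Minimality for in_concept Sort Prop.
Combined Scheme in_role_concept_ind from in_role_mut, in_concept_mut.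

Section Preservation.
Local Open Scope ring_scope.
Variables (R : realType) (CN RN IN : Type) (Phi : set feature).
Local Notation role := (role R CN RN IN).
Local Notation concept := (concept R CN RN IN).
Local Notation interp := (interp R CN RN IN).

(** Here [h] acts on truth values and [f] on points. Constants up to [c] are fixed by
    [similarity_fix], the constant [1] by [similarity_hom]. *)
Record similarity (c : R) (h : R -> R) (I J : interp)
    (f : idom I -> idom J) : Prop := {
  similarity_hom : godel_hom h;
  similarity_fix : forall p, p <= c -> h p = p;
  similarity_bij : bijective f;
  similarity_ind : forall a, iind J a = f (iind I a);
  similarity_con : forall A x, transported h (icon A x) (icon A (f x));
  similarity_role : forall r x y,
    transported h (irole r x y) (irole r (f x) (f y)) }.

(** All similarities are quantified inside, which leaves a predicate of [c] alone, as [near_one]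
    expects. *)
Definition role_preserved (S : role) (c : R) : Prop :=
  forall h I J f, @similarity c h I J f ->
  forall x y, transported h (role_sem S x y) (role_sem S (f x) (f y)).

Definition concept_preserved (C : concept) (c : R) : Prop :=
  forall h I J f, @similarity c h I J f ->
  forall x, transported h (concept_sem C x) (concept_sem C (f x)).

Lemma basic_role_preserved S c : basic_role Phi S -> role_preserved S c.
Proof.
by move=> [[r ->]|[_ [r ->]]] h I J f sim x y /=; exact: similarity_role sim _ _ _.
Qed.

Lemma in_logic_preserved :
  (forall S, in_role NoInvol Phi S -> near_one (role_preserved S)) /\
  (forall C, in_concept NoInvol Phi C -> near_one (concept_preserved C)).
Proof.
(* Three forms of induction step, for zero, one or two eventual premises. *)
have basic Q (H : forall c, Q c) := near_oneT H.
have unary P Q (H : forall c, P c -> Q c) := near_oneS H.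
have binary P P' Q (H : forall c, P c /\ P' c -> Q c) H1 H2 :
  near_one Q := near_oneS H (near_oneI H1 H2).
apply: in_role_concept_ind.
- by move=> r; apply: basic => c; apply: basic_role_preserved; left; exists r.
- move=> S T _ + _; apply: binary => c [Sc Tc] h I J f sim x y /=.
  have [hh _ [g fK gK] _ _ _] := sim.
  apply: (transported_sup_range hh gK) => z.
  by apply: transported_min => //; [exact: Sc sim _ _ | exact: Tc sim _ _].
- move=> S T _ + _; apply: binary => c [Sc Tc] h I J f sim x y /=.
  have [hh _ _ _ _ _] := sim.
  by apply: transported_max => //; [exact: Sc sim _ _ | exact: Tc sim _ _].
- move=> S _; apply: unary => c Sc h I J f sim x y /=.
  have [hh _ [g fK gK] _ _ _] := sim.
  by apply: (transported_star hh fK gK) => {}x {}y; exact: Sc sim _ _.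
- move=> C _; apply: unary => c Cc h I J f sim x y /=.
  have [hh _ [g fK gK] _ _ _] := sim.
  have -> : `[< f x = f y >] = `[< x = y >].
    by apply: asbool_equiv_eq; split=> [/(can_inj fK)|->].
  by case: ifP => _; [exact: Cc sim _ | exact: transported0].
- move=> S _ _; apply: unary => c Sc h I J f sim x y /=; exact: Sc sim _ _.
- move=> _; apply: basic => c h I J f [hh _ _ _ _ _] x y /=; exact: transported1.
(* Constants are the only source of a restriction on [c]. *)
- move=> p p01; apply: unary (near_one_const p01) => c pc h I J f.
  move=> [hh fix_h _ _ _ _] x /=; split=> //.
  by case: pc => [/fix_h|->] //; case: hh.
- by move=> A; apply: basic => c h I J f sim x /=; exact: similarity_con sim _ _.
- move=> C D _ + _; apply: binary => c [Cc Dc] h I J f sim x /=.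
  have [hh _ _ _ _ _] := sim.
  by apply: transported_min => //; [exact: Cc sim _ | exact: Dc sim _].
- move=> C D _ + _; apply: binary => c [Cc Dc] h I J f sim x /=.
  have [hh _ _ _ _ _] := sim.
  by apply: transported_impl => //; [exact: Cc sim _ | exact: Dc sim _].
- move=> C _; apply: unary => c Cc h I J f sim x /=.
  have [hh _ _ _ _ _] := sim.
  by apply: transported_neg => //; exact: Cc sim _.
- move=> C D _ + _; apply: binary => c [Cc Dc] h I J f sim x /=.
  have [hh _ _ _ _ _] := sim.
  by apply: transported_max => //; [exact: Cc sim _ | exact: Dc sim _].
- move=> S C _ + _; apply: binary => c [Sc Cc] h I J f sim x /=.
  have [hh _ [g fK gK] _ _ _] := sim.
  apply: (transported_inf_range hh gK); first exact: idom_nonempty.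
  by move=> z; apply: transported_impl => //; [exact: Sc sim _ _ | exact: Cc sim _].
- move=> S C _ + _; apply: binary => c [Sc Cc] h I J f sim x /=.
  have [hh _ [g fK gK] _ _ _] := sim.
  apply: (transported_sup_range hh gK) => z.
  by apply: transported_min => //; [exact: Sc sim _ _ | exact: Cc sim _].
- move=> a _; apply: basic => c h I J f sim x /=.
  have [hh _ [g fK gK] find _ _] := sim.
  have -> : `[< f x = iind J a >] = `[< x = iind I a >].
    by apply: asbool_equiv_eq; rewrite find; split=> [/(can_inj fK)|->].
  by case: ifP => _; [exact: transported1 | exact: transported0].
- by move=> r _; apply: basic => c h I J f sim x /=; exact: similarity_role sim _ _ _.
- move=> n S C _ Sb _; apply: unary => c Cc h I J f sim x /=.
  have [hh _ [g fK gK] _ _ _] := sim.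
  apply: (transported_at_least hh fK gK) => [y z|y]; last exact: Cc sim _.
  exact: (basic_role_preserved Sb) sim _ _.
- move=> n S C _ Sb _; apply: unary => c Cc h I J f sim x /=.
  have [hh _ [g fK gK] _ _ _] := sim.
  apply: (transported_less hh fK gK) => [y z|y]; last exact: Cc sim _.
  exact: (basic_role_preserved Sb) sim _ _.
- move=> n S _ Sb; apply: basic => c h I J f sim x /=.
  have [hh _ [g fK gK] _ _ _] := sim.
  apply: (transported_at_least hh fK gK) => [y z|y]; last exact: transported1.
  exact: (basic_role_preserved Sb) sim _ _.
- move=> n S _ Sb; apply: basic => c h I J f sim x /=.
  have [hh _ [g fK gK] _ _ _] := sim.
  apply: (transported_less hh fK gK) => [y z|y]; last exact: transported1.
  exact: (basic_role_preserved Sb) sim _ _.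
(* The last two cases would equate [NoInvol] with another mode. *)
- by [].
- by [].
Qed.

End Preservation.

(** * The maps [collapse c k] and their joint effect on comparisons *)

Section Collapse.
Local Open Scope ring_scope.
Variable R : realType.
Implicit Types c k p v w : R.

(** In the coordinate [(v - c) / (1 - v)] on [(c, 1)], this is multiplication by
    [k] followed by truncation at [1]. *)
Definition collapse c k v : R :=
  if v <= c then v
  else c + (1 - c) * (k * (v - c) / Num.max (1 - v) (k * (v - c))).

(** For [c < w <= 1] this is the least [v] with [w <= collapse c k v], obtained by solving the
    untruncated branch for [v]; at [w = 1] it is [(1 + k * c) / (1 + k)], where truncation sets
    in. *)
Definition collapse_adj c k w : R :=
  if w <= c then w
  else (c * (k * (1 - c)) + (w - c)) / (k * (1 - c) + (w - c)).

Lemma collapse_id c k p : p <= c -> collapse c k p = p.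
Proof. by rewrite /collapse => ->. Qed.

Lemma collapse1 c k : 0 < k -> c < 1 -> collapse c k 1 = 1.
Proof.
move=> k0 c1; rewrite /collapse leNgt c1 /= subrr max_r; last nra.
by rewrite divff ?mulr1; [lra | rewrite mulf_neq0; lra].
Qed.

(** Above [c] the maximum is positive, even at [v = 1], so the division can be cleared. *)
Lemma collapse_le_iff c k v w : 0 < k -> c < 1 -> c < v ->
  (collapse c k v <= w) =
  ((1 - c) * (k * (v - c)) <= (w - c) * Num.max (1 - v) (k * (v - c))).
Proof.
move=> k0 c1 cv; have t0 : 0 < k * (v - c) by nra.
have M0 : 0 < Num.max (1 - v) (k * (v - c)) by rewrite lt_max t0 orbT.
rewrite /collapse [v <= c]leNgt cv /= -lerBrDl mulrA ler_pdivrMr //.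
Qed.

Lemma collapse_ge_iff c k v w : 0 < k -> c < 1 -> c < v ->
  (w <= collapse c k v) =
  ((w - c) * Num.max (1 - v) (k * (v - c)) <= (1 - c) * (k * (v - c))).
Proof.
move=> k0 c1 cv; have t0 : 0 < k * (v - c) by nra.
have M0 : 0 < Num.max (1 - v) (k * (v - c)) by rewrite lt_max t0 orbT.
rewrite /collapse [v <= c]leNgt cv /= -lerBlDl mulrA ler_pdivlMr //.
Qed.

Lemma collapse_le1 c k v : 0 < k -> c < 1 -> collapse c k v <= 1.
Proof.
move=> k0 c1; have [vc|cv] := leP v c.
  by rewrite collapse_id// (le_trans vc)// ltW.
rewrite collapse_le_iff// ler_wpM2l//; first lra.
by rewrite le_max lexx orbT.
Qed.

Lemma collapse_hom c k : 0 < k -> 0 <= c < 1 -> godel_hom (collapse c k).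
Proof.
move=> k0 /andP[c0 c1]; split.
- exact: collapse_id.
- exact: collapse1.
- by move=> v; exact: collapse_le1.
have a0 : 0 < k * (1 - c) by rewrite mulr_gt0 ?subr_gt0.
have gtE v : (1 - c) * (k * (v - c)) = k * (1 - c) * (v - c) by ring.
exists (collapse_adj c k); split=> v w w1; rewrite /collapse_adj.
- have [vc|cv] := leP v c.
    rewrite collapse_id//; case: (leP w c) => // cw.
    rewrite ler_pdivrMr; last by rewrite addr_gt0 ?subr_gt0.
    have H1 : 0 <= (c - v) * (k * (1 - c)) by rewrite mulr_ge0 ?subr_ge0// ltW.
    have H2 : 0 < (1 - v) * (w - c) by rewrite mulr_gt0 ?subr_gt0// (le_lt_trans vc).
    by apply/idP/idP; lra.
  have t0 : 0 < k * (v - c) by rewrite mulr_gt0 ?subr_gt0.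
  have u0 : 0 < k * (1 - c) * (v - c) by rewrite mulr_gt0 ?subr_gt0.
  rewrite collapse_ge_iff// gtE; case: (leP w c) => [wc|cw].
    rewrite (le_trans wc (ltW cv)) (le_trans _ (ltW u0))// mulr_le0_ge0 ?subr_le0//.
    by rewrite le_max (ltW t0) orbT.
  rewrite ler_pdivrMr; last by rewrite addr_gt0 ?subr_gt0.
  (* Under truncation both inequalities hold because [w <= 1]; otherwise they are rearrangements of
     each other. *)
  have [M|M] := leP (1 - v) (k * (v - c)); last by apply/idP/idP; lra.
  have H1 : (w - c) * (k * (v - c)) <= (1 - c) * (k * (v - c)).
    by rewrite ler_pM2r//; lra.
  have H2 : (w - c) * (1 - v) <= (w - c) * (k * (v - c)).
    by rewrite ler_pM2l// subr_gt0.
  by move: H1; rewrite gtE => H1; apply/idP/idP; lra.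
- have [vc|cv] := leP v c.
    rewrite collapse_id//; case: (leP w c) => // cw.
    rewrite ler_pdivlMr; last by rewrite addr_gt0 ?subr_gt0.
    have H1 : 0 <= (c - v) * (k * (1 - c)) by rewrite mulr_ge0 ?subr_ge0// ltW.
    have H2 : 0 < (1 - v) * (w - c) by rewrite mulr_gt0 ?subr_gt0// (le_lt_trans vc).
    by apply/idP/idP; lra.
  have t0 : 0 < k * (v - c) by rewrite mulr_gt0 ?subr_gt0.
  have u0 : 0 < k * (1 - c) * (v - c) by rewrite mulr_gt0 ?subr_gt0.
  rewrite collapse_le_iff// gtE; case: (leP w c) => [wc|cw].
    have M0 : (w - c) * Num.max (1 - v) (k * (v - c)) <= 0.
      by rewrite mulr_le0_ge0 ?subr_le0// le_max (ltW t0) orbT.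
    by apply/idP/idP; lra.
  rewrite ler_pdivlMr; last by rewrite addr_gt0 ?subr_gt0.
  (* Under truncation both inequalities now fail, which is where [w < 1] matters. *)
  have [M|M] := leP (1 - v) (k * (v - c)); last by apply/idP/idP; lra.
  have H1 : (w - c) * (k * (v - c)) < (1 - c) * (k * (v - c)).
    by rewrite ltr_pM2r//; lra.
  have H2 : (w - c) * (1 - v) <= (w - c) * (k * (v - c)).
    by rewrite ler_pM2l// subr_gt0.
  by move: H1; rewrite gtE => H1; apply/idP/idP; lra.
Qed.

Lemma collapse_lt1 c v : 0 <= c < 1 -> v < 1 ->
  exists2 k, 0 < k & collapse c k v < 1.
Proof.
move=> /andP[c0 c1] v1; have [vc|cv] := leP v c.
  by exists 1; rewrite ?ltr01// collapse_id.
(* This [k] makes [k * (v - c)] half of [1 - v], so the image is the midpoint of [c] and [1]. *)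
exists ((1 - v) / (2 * (v - c))); first by rewrite divr_gt0; nra.
have kE : (1 - v) / (2 * (v - c)) * (v - c) = (1 - v) / 2 by field; lra.
rewrite ltNge collapse_ge_iff//; last by rewrite divr_gt0; nra.
rewrite kE max_l; nra.
Qed.

Lemma cmp_sem_collapse c k v o p : 0 <= c < 1 -> 0 < k -> v <= 1 ->
  p <= c \/ p = 1 -> o = CmpGe \/ o = CmpGt ->
  cmp_sem o v p -> cmp_sem o (collapse c k v) p.
Proof.
move=> c01 k0 v1 pc; have /andP[_ c1] := c01.
have hh := collapse_hom k0 c01.
have hp : collapse c k p = p by case: pc => [/collapse_id|->] //; exact: collapse1.
case=> -> /= pv; rewrite -hp; first exact: godel_hom_mono.
by apply: godel_hom_strict => //; rewrite hp (lt_le_trans pv).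
Qed.

(** A single [k] may send [v < 1] to [1], so [v >= 1] is recovered only from small [k]. In the other
    cases [k = 1] suffices: values up to [c] do not move, and nothing exceeds [1]. *)
Lemma cmp_sem_collapse_inv c v o p : 0 <= c < 1 ->
  p <= c \/ p = 1 -> o = CmpGe \/ o = CmpGt ->
  (forall k, 0 < k -> cmp_sem o (collapse c k v) p) -> cmp_sem o v p.
Proof.
move=> c01 pc oE H; have /andP[_ c1] := c01; have H1 := H 1 ltr01.
case: oE => oE; rewrite {}oE /= in H H1 *.
- rewrite leNgt; apply/negP => vp; case: pc => [pc|p1].
    by move: H1; rewrite collapse_id ?(le_trans (ltW vp))// leNgt vp.
  rewrite p1 in H vp; have [k k0] := collapse_lt1 c01 vp.
  by rewrite ltNge H.
- rewrite ltNge; apply/negP => vp; case: pc => [pc|p1].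
    by move: H1; rewrite collapse_id ?(le_trans vp)// ltNge vp.
  by move: H1; rewrite p1 ltNge collapse_le1 ?ltr01.
Qed.

(** A value [v'] that is the collapse of [v] for all [k] at once obeys the same comparisons; [<=]
    and [<] follow by negating [>] and [>=]. *)
Lemma cmp_sem_collapse_eq c v v' o p : 0 <= c < 1 -> v <= 1 ->
  (forall k, 0 < k -> v' = collapse c k v) -> p <= c \/ p = 1 ->
  cmp_sem o v p <-> cmp_sem o v' p.
Proof.
move=> c01 v1 v'E pc.
have up o' : o' = CmpGe \/ o' = CmpGt -> cmp_sem o' v p <-> cmp_sem o' v' p.
  move=> oE; split=> [|H].
    by rewrite (v'E 1 ltr01); exact: cmp_sem_collapse.
  by apply: cmp_sem_collapse_inv c01 pc oE _ => k /v'E <-.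
have Ege : (p <= v) = (p <= v') by apply/idP/idP; case: (up CmpGe (or_introl erefl)).
have Egt : (p < v) = (p < v') by apply/idP/idP; case: (up CmpGt (or_intror erefl)).
case: o => /=; [by rewrite Ege | by rewrite Egt | |].
  by rewrite !leNgt Egt.
by rewrite !ltNge Ege.
Qed.

End Collapse.

(** * The two interpretations on the real line, their scalings, and the separating concept *)

Section Models.
Local Open Scope ring_scope.
Variables (R : realType) (CN RN IN : Type).
Local Notation concept := (concept R CN RN IN).
Local Notation role := (role R CN RN IN).
Implicit Types (c k p v : R) (Phi : set feature).

(** Individuals sit at the origin because every scaling fixes it. *)
Definition line_interp (f : R -> R) (f01 : forall x, 0 <= f x <= 1) :
    interp R CN RN IN :=
  @Interp R CN RN IN R (inhabits 0) (fun=> 0) (fun=> f) (fun _ _ _ => 1)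
    (fun=> f01) (fun _ _ _ => unit1 R).

Variable c : R.
Hypothesis c01 : 0 <= c < 1.

(** For [y > 0] this is the point of [(c, 1)] with coordinate [(v - c) / (1 - v) = y], so that
    scaling [y] scales the coordinate. *)
Definition approaching (y : R) : R := if y <= 0 then 0 else (c + y) / (1 + y).

Definition attaining (y : R) : R :=
  if y <= 0 then 0 else c + (1 - c) * Num.min 1 y.

Lemma approaching_lt1 y : 0 <= approaching y < 1.
Proof.
have /andP[c0 c1] := c01; rewrite /approaching.
case: (leP y 0) => y0; first by rewrite lexx ltr01.
by rewrite divr_ge0 ?ltr_pdivrMr; lra.
Qed.

Lemma approaching_unit y : 0 <= approaching y <= 1.
Proof. by have /andP[-> /ltW->] := approaching_lt1 y. Qed.

Lemma attaining_unit y : 0 <= attaining y <= 1.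
Proof.
have /andP[c0 c1] := c01; rewrite /attaining.
case: (leP y 0) => y0; first by rewrite lexx ler01.
by case: (leP 1 y) => y1; nra.
Qed.

Definition approaching_interp := line_interp approaching_unit.
Definition attaining_interp := line_interp attaining_unit.

Lemma collapse_approaching k y : 0 < k ->
  attaining (k * y) = collapse c k (approaching y).
Proof.
move=> k0; have /andP[c0 c1] := c01; rewrite /attaining /approaching pmulr_rle0//.
case: (leP y 0) => y0; first by rewrite collapse_id.
have y1 : 0 < 1 + y by lra.
have cv : c < (c + y) / (1 + y) by rewrite ltr_pdivlMr//; nra.
rewrite /collapse leNgt cv /=; congr (_ + _ * _).
(* The common factor [(1 - c) / (1 + y)] cancels and leaves [k * y / Num.max 1 (k * y)], which is
   [Num.min 1 (k * y)]. *)
have -> : k * ((c + y) / (1 + y) - c) = (1 - c) / (1 + y) * (k * y) by field; lra.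
have -> : 1 - (c + y) / (1 + y) = (1 - c) / (1 + y) * 1 by field; lra.
have q0 : 0 < (1 - c) / (1 + y) by rewrite divr_gt0; lra.
rewrite -maxr_pMr ?ltW// -mulf_div divff ?gt_eqF// mul1r.
have ky0 : 0 < k * y by rewrite mulr_gt0.
case: (leP 1 (k * y)) => _; first by rewrite divff ?gt_eqF.
by rewrite divr1.
Qed.

Lemma scaling_similarity k : 0 < k ->
  similarity c (collapse c k) (I := approaching_interp) (J := attaining_interp)
    (fun y => k * y).
Proof.
move=> k0; have hh := collapse_hom k0 c01; split.
- exact: hh.
- by move=> p; exact: collapse_id.
- by exists (fun y => k^-1 * y) => y; rewrite mulrA ?mulVf ?divff ?mul1r ?gt_eqF.
- by move=> a /=; rewrite mulr0.
- move=> A y; split; first exact: approaching_unit.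
  exact: collapse_approaching.
- by move=> r x y; exact: transported1.
Qed.

(** Since [k * 0 = 0], the value at the second origin is the collapse of the first for every [k]. *)
Lemma concept_cmp_origin (C : concept) o p :
  concept_preserved C c -> p <= c \/ p = 1 ->
  cmp_sem o (concept_sem C (0 : idom approaching_interp)) p <->
  cmp_sem o (concept_sem C (0 : idom attaining_interp)) p.
Proof.
move=> Cc pc; apply: (cmp_sem_collapse_eq _ c01) => //.
  by case: (Cc _ _ _ _ (scaling_similarity ltr01) 0) => /andP[].
move=> k k0; have [_ <-] := Cc _ _ _ _ (scaling_similarity k0) 0.
by rewrite mulr0.
Qed.

Lemma role_cmp_origin (S : role) o p :
  role_preserved S c -> p <= c \/ p = 1 ->
  cmp_sem o (role_sem S (0 : idom approaching_interp) 0) p <->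
  cmp_sem o (role_sem S (0 : idom attaining_interp) 0) p.
Proof.
move=> Sc pc; apply: (cmp_sem_collapse_eq _ c01) => //.
  by case: (Sc _ _ _ _ (scaling_similarity ltr01) 0 0) => /andP[].
move=> k k0; have [_ <-] := Sc _ _ _ _ (scaling_similarity k0) 0 0.
by rewrite mulr0.
Qed.

(** From left to right the scaling by [1] is enough. Conversely, all points [k * x] of the second
    line together decide the comparison at [x]. *)
Lemma concept_cmp_everywhere (C : concept) o p :
  concept_preserved C c -> p <= c \/ p = 1 -> o = CmpGe \/ o = CmpGt ->
  (forall x : idom approaching_interp, cmp_sem o (concept_sem C x) p) <->
  (forall x : idom attaining_interp, cmp_sem o (concept_sem C x) p).
Proof.
move=> Cc pc oE; split=> [H y|H x].
  have [v01 vE] := Cc _ _ _ _ (scaling_similarity ltr01) (y : R).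
  rewrite mul1r in vE; rewrite vE; apply: cmp_sem_collapse => //.
  by case/andP: v01.
apply: cmp_sem_collapse_inv c01 pc oE _ => k k0.
by have [_ <-] := Cc _ _ _ _ (scaling_similarity k0) x.
Qed.

(** The inner negation detects the value [1] of [A]; the quantifier spreads the answer to every
    point, in particular to the individuals. *)
Definition baaz_witness (r : RN) (A : CN) : concept :=
  CExists (RName R CN IN r) (CNeg (CInvol (CName R RN IN A))).

Lemma baaz_witness_approaching r A (x : idom approaching_interp) :
  concept_sem (baaz_witness r A) x = 0.
Proof.
rewrite /= -[RHS](sup1 0); congr sup; apply/seteqP.
have E y : Num.min 1 (gneg (1 - approaching y)) = 0.
  have /andP[_ y1] := approaching_lt1 y.
  by rewrite /gneg gt_eqF ?subr_gt0// min_r// ler01.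
by split=> [_ [y _ <-]|_ ->] /=; [exact: E | exists 0; rewrite ?E].
Qed.

Lemma baaz_witness_attaining r A (x : idom attaining_interp) :
  concept_sem (baaz_witness r A) x = 1.
Proof.
have S01 : in_unit [set Num.min 1 (gneg (1 - attaining y)) | y in [set: R]].
  by move=> _ [y _ <-]; apply: min_unit; [exact: unit1 | exact: gneg_unit].
have /andP[_ S1] := sup_unit S01.
apply/eqP; rewrite eq_le; apply/andP; split; first exact: S1.
apply: ub_le_sup; first exact: in_unit_has_ubound.
(* The point [y = 1] is where [attaining] first reaches the value [1]. *)
exists 1 => //=; rewrite /attaining leNgt ltr01 /= minxx mulr1 [c + _]addrC subrK subrr.
by rewrite /gneg eqxx minxx.
Qed.

End Models.

(** * Inexpressibility of the witness as a concept, an ABox and a TBox *)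

Section Inexpressibility.
Local Open Scope ring_scope.
Variables (R : realType) (CN RN IN : Type) (Phi : set feature).
Local Notation concept := (concept R CN RN IN).
Local Notation role := (role R CN RN IN).
Local Notation approaching_interp := (@approaching_interp R CN RN IN _).
Local Notation attaining_interp := (@attaining_interp R CN RN IN _).

(** The proof [c01] is quantified under [near_one] because both interpretations are built from it.
    Equalities between individuals agree trivially, all individuals being the origin. *)
Lemma assertion_near_one (phi : assertion R CN RN IN) :
  assertion_in (LPhi R CN RN IN Phi) phi ->
  near_one (fun c : R => forall c01 : 0 <= c < 1,
    validates_assertion (approaching_interp c01) phi <->
    validates_assertion (attaining_interp c01) phi).
Proof.
have [Rpres Cpres] := in_logic_preserved R CN RN IN Phi.
case: phi => [a b|a b|C a o p|S a b o p] /=; try by move=> _; exact: near_oneT.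
- move=> [/Cpres Cc /near_one_const pc].
  by apply: near_oneS (near_oneI Cc pc) => c [{}Cc {}pc] c01; exact: concept_cmp_origin.
- move=> [/Rpres Sc /near_one_const pc].
  by apply: near_oneS (near_oneI Sc pc) => c [{}Sc {}pc] c01; exact: role_cmp_origin.
Qed.

(** A GCI bounds the single concept [CImpl] from below at every point, which is what
    [concept_cmp_everywhere] compares. *)
Lemma gci_near_one (g : gci R CN RN IN) :
  gci_in (LPhi R CN RN IN Phi) g ->
  near_one (fun c : R => forall c01 : 0 <= c < 1,
    validates_gci (approaching_interp c01) g <->
    validates_gci (attaining_interp c01) g).
Proof.
have [_ Cpres] := in_logic_preserved R CN RN IN Phi.
move=> [gl gr gE /andP[/ltW p0 p1]].
have /near_one_const pc : 0 <= gdeg g <= 1 by rewrite p0.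
have Cc := Cpres _ (in_CImpl gl gr).
apply: near_oneS (near_oneI Cc pc) => c [{}Cc {}pc] c01.
exact: concept_cmp_everywhere.
Qed.

Lemma baaz_concept_inexpressible r A :
  ~ exists D : concept, in_concept NoInvol Phi D /\
      equiv_concept (baaz_witness R IN r A) D.
Proof.
move=> [D [/(in_logic_preserved R CN RN IN Phi).2 /near_one_ex[c c01 Dc] DE]].
have := concept_cmp_origin c01 CmpGe Dc (or_intror erefl).
rewrite -!DE baaz_witness_approaching baaz_witness_attaining /= lexx ler10.
by case=> _ /(_ isT).
Qed.

Lemma baaz_abox_inexpressible r A a :
  ~ exists B, is_abox (LPhi R CN RN IN Phi) B /\
      equiv_abox [set AConcept (baaz_witness R IN r A) a CmpGe 1] B.
Proof.
move=> [B [[Bfin BPhi] BE]].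
(* Finiteness of [B] yields one [c] that works for all its assertions. *)
have /(near_one_finite Bfin)/near_one_ex[c c01 BC] :
  forall phi, B phi -> _ := fun phi Bphi => assertion_near_one (BPhi phi Bphi).
have J : abox_model B (attaining_interp c01).
  by apply/BE => _ ->; rewrite /validates_assertion baaz_witness_attaining /=.
have : abox_model B (approaching_interp c01).
  by move=> phi Bphi; apply/(BC phi Bphi c01)/J.
by move=> /BE/(_ _ erefl); rewrite /validates_assertion baaz_witness_approaching /= ler10.
Qed.

Lemma baaz_tbox_inexpressible r A :
  ~ exists T, is_tbox (LPhi R CN RN IN Phi) T /\
      equiv_tbox [set Gci (CConst CN RN IN 1) (baaz_witness R IN r A) CmpGe 1] T.
Proof.
move=> [T [[Tfin TPhi] TE]].
have /(near_one_finite Tfin)/near_one_ex[c c01 TC] :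
  forall g, T g -> _ := fun g Tg => gci_near_one (TPhi g Tg).
have J : tbox_model T (attaining_interp c01).
  apply/TE => _ -> x.
  change (1 <= gimpl 1 (concept_sem (baaz_witness R IN r A) x)).
  by rewrite baaz_witness_attaining /gimpl lexx.
have : tbox_model T (approaching_interp c01).
  by move=> g Tg; apply/(TC g Tg c01)/J.
move=> /TE/(_ _ erefl 0).
change (1 <= gimpl 1 (concept_sem (baaz_witness R IN r A)
  (0 : idom (approaching_interp c01))) -> False).
by rewrite baaz_witness_approaching /gimpl ler10 ler10.
Qed.

Lemma LPhi_sublogic m : sublogic (LPhi R CN RN IN Phi) (logic_of R CN RN IN m Phi).
Proof.
by apply: in_role_concept_ind; try by [constructor | constructor; auto].
Qed.

Lemma baaz_witness_in m (r : RN) (A : CN) : m <> NoInvol ->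
  in_concept m Phi (baaz_witness R IN r A).
Proof.
move=> m0; apply: in_CExists; first exact: in_RName.
case: m m0 => // _; first by apply: in_CBaaz => //; exact: in_CName.
by apply/in_CNeg/in_CInvol => //; exact: in_CName.
Qed.

(** The witness uses [CInvol] only directly under [CNeg], so the same concept, assertion and GCI
    serve both extended logics. *)
Lemma more_expressive_logic_of m (A : CN) (r : RN) (a : IN) : m <> NoInvol ->
  [/\ more_expressive_concepts (logic_of R CN RN IN m Phi) (LPhi R CN RN IN Phi),
      more_expressive_aboxes (logic_of R CN RN IN m Phi) (LPhi R CN RN IN Phi) &
      more_expressive_tboxes (logic_of R CN RN IN m Phi) (LPhi R CN RN IN Phi)].
Proof.
move=> /(baaz_witness_in r A) W.
split; (split; first exact: LPhi_sublogic).
- by exists (baaz_witness R IN r A); split=> //; exact: baaz_concept_inexpressible.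
- exists [set AConcept (baaz_witness R IN r A) a CmpGe 1].
  split; last exact: baaz_abox_inexpressible.
  by split=> [|_ ->]; [exact: finite_set1 | split=> //; exact: unit1].
- exists [set Gci (CConst CN RN IN 1) (baaz_witness R IN r A) CmpGe 1].
  split; last exact: baaz_tbox_inexpressible.
  split=> [|_ ->]; first exact: finite_set1.
  split=> //=; [exact/in_CConst/unit1 | by left | by rewrite ltr01 lexx].
Qed.

End Inexpressibility.

Theorem theorem10 (R : realType) (CN RN IN : Type)
    (hCN : inhabited CN) (hRN : inhabited RN) (hIN : inhabited IN) :
  (forall Phi : set feature, Phi `<=` PhiF ->
     more_expressive_concepts (LInvol R CN RN IN Phi) (LPhi R CN RN IN Phi) /\
     more_expressive_concepts (LBaaz R CN RN IN Phi) (LPhi R CN RN IN Phi)) /\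
  (forall Phi : set feature, Phi `<=` PhiF ->
     ([set FI; FO; FU] `\` Phi !=set0 \/ exists n, (2 <= n)%N /\ Phi (FQ n)) ->
     more_expressive_aboxes (LInvol R CN RN IN Phi) (LPhi R CN RN IN Phi) /\
     more_expressive_aboxes (LBaaz R CN RN IN Phi) (LPhi R CN RN IN Phi)) /\
  (forall Phi : set feature, Phi `<=` PhiF ->
     ([set FI; FO] `\` Phi !=set0 \/ exists n, (2 <= n)%N /\ Phi (FQ n)) ->
     more_expressive_tboxes (LInvol R CN RN IN Phi) (LPhi R CN RN IN Phi) /\
     more_expressive_tboxes (LBaaz R CN RN IN Phi) (LPhi R CN RN IN Phi)).
Proof.
have [A] := hCN; have [r] := hRN; have [a] := hIN.
have H Phi m : m <> NoInvol -> _ := more_expressive_logic_of R Phi A r a (m := m).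
by split; [|split] => Phi *; split; apply H.
Qed.
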